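(* For any integer $a\ge 1$, any positive odd integer $n$ and any integer $j$ with $0\le j\le n-1$, $$\left(\!\!\binom{an-1}{an-n+j}\!\!\right)_q\equiv\left(\frac{n-j}{3}\right)q^{(n-j-1)(n-j-2)/6-(j^2+j)/2}\pmod{\Phi_n(q)}.$$
   Context: $q$ is an indeterminate. $\Phi_n(q)=\prod_{1\le k\le n,\ \gcd(n,k)=1}(q-\zeta^k)$, with $\zeta$ a primitive $n$-th root of unity, is the $n$-th cyclotomic polynomial. The $q$-shifted factorial is $(a;q)_0=1$, $(a;q)_n=(1-a)(1-aq)\cdots(1-aq^{n-1})$ for $n\ge 1$. The $q$-binomial coefficient is $\begin{bmatrix}n\\k\end{bmatrix}=\frac{(q;q)_n}{(q;q)_k(q;q)_{n-k}}$ if $0\le k\le n$, and $0$ otherwise. For integers $n\ge 0$ and $-n\le j\le n$, the $q$-trinomial coefficient is $$\left(\!\!\binom{n}{j}\!\!\right)_q=\sum_{k=0}^{n}q^{k(k+j)}\begin{bmatrix}n\\k\end{bmatrix}\begin{bmatrix}n-k\\k+j\end{bmatrix}.$$ $\left(\frac{\cdot}{3}\right)$ denotes the Legendre symbol modulo $3$ (values $0,1,-1$ for arguments congruent to $0,1,2$ modulo $3$). A term whose Legendre symbol is $0$ is read as $0$ (the exponent of $q$ is an integer whenever the symbol is nonzero). A congruence $A(q)\equiv B(q)$ modulo $\Phi_n(q)$ means that $\Phi_n(q)$ divides $A(q)-B(q)$ in $\mathbb{Z}[q,q^{-1}]$. *)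

(* Defs.v *)
From HB Require Import structures.
From mathcomp Require Import all_boot all_order all_algebra all_field.

Set Implicit Arguments.
Unset Strict Implicit.
Unset Printing Implicit Defensive.

Import Order.TTheory GRing.Theory Num.Theory.
Local Open Scope ring_scope.

(* All q-series live in the field of fractions of Z[q]; Z[q, q^-1] is the
   subring singled out by [is_laurent]. *)
Definition Zq : fieldType := {fraction {poly int}}.

Definition of_poly (p : {poly int}) : Zq := @tofrac {poly int} p.

Definition q : Zq := of_poly 'X.

Definition is_laurent (x : Zq) : Prop :=
  exists (p : {poly int}) (m : nat), x = of_poly p / q ^+ m.

(* A = B mod P in Z[q, q^-1] *)
Definition laurent_eqmod (P : {poly int}) (A B : Zq) : Prop :=
  exists2 L : Zq, is_laurent L & A - B = of_poly P * L.

Definition qpoch (a : Zq) (n : nat) : Zq := \prod_(i < n) (1 - a * q ^+ i).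

Definition qbinom (n : nat) (k : int) : Zq :=
  match k with
  | Posz k' =>
      if (k' <= n)%N then qpoch q n / (qpoch q k' * qpoch q (n - k')) else 0
  | Negz _ => 0
  end.

(* Meant for - n <= j <= n. The exponent is an integer power in Zq; it is
   nonnegative whenever the binomials do not vanish. *)
Definition qtrinom (n : nat) (j : int) : Zq :=
  \sum_(k < n.+1)
     q ^ (k%:Z * (k%:Z + j)) * qbinom n k%:Z * qbinom (n - k) (k%:Z + j).

(* The remainder (_ %% 3)%Z lies in {0, 1, 2}. *)
Definition legendre3 (m : int) : int :=
  if (m %% 3)%Z == 1 then 1 else if (m %% 3)%Z == 2 then -1 else 0.

(* Main.v *)
Require Import Defs.
From HB Require Import structures.
From mathcomp Require Import all_boot all_order all_algebra all_field.
From mathcomp Require Import ring zify.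

Set Implicit Arguments.
Unset Strict Implicit.
Unset Printing Implicit Defensive.

Import Order.TTheory GRing.Theory Num.Theory.
Local Open Scope ring_scope.

(** The q-trinomial coefficient is a polynomial in q, so the congruence modulo
    the n-th cyclotomic polynomial is an equality of values at a primitive
    n-th root of unity z ([laurent_eqmod_root_of_unity]): this polynomial is
    monic and is the minimal polynomial of z.

    Put M = n - 1 - j and J = (a - 1) n + j, so that an - 1 = J + M. Modulo n,
    the exponents an - i and - i agree, and for m < n this turns each factor
    1 - z^(an-i) of the numerator of a Gaussian binomial into
    - z^(-i) (1 - z^i). The outcome is the reflection formula
      z^(s m + m(m+1)/2) [an-1-s, m] = (-1)^m [s+m, m]
    ([gbin_reflect]). It applies to both binomials of the k-th term of the
    trinomial: to [an-1, k], and to [an-1-k, k+J], which by symmetry is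
    [an-1-k, M-2k]. Terms with 2k > M vanish, hence k and M - 2k are less
    than n. Collecting the powers of z gives ([gtrinom_root_of_unity])
      z^(M(M+1)/2) * trinomial
        = (-1)^M \sum_k (-1)^k z^(k(k-1)/2) [M-k, k].

    The alternating sum S_M on the right is a q-analogue of the diagonal sums
    of Pascal's triangle with signs, which have period 6. It satisfies
    S_(M+3) = - x^(M+1) S_M identically in x ([alt_sum_rec3]), with
    S_0 = S_1 = 1 and S_2 = 0, hence it is a Legendre symbol times a power of x
    ([alt_sum_closed]). Finally z^(M(M+1)/2) = z^(j(j+1)/2): as j + M + 1 = n,
    the two exponents differ by n M - n (n - 1) / 2, a multiple of n because n
    is odd. *)

(** * Gaussian binomial coefficients over an arbitrary ring *)

(** Defined by the q-Pascal rule and not as a quotient, so that it commutes with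
    ring morphisms: the same expression can be read in Z[q], in the fraction
    field and at a root of unity, where the quotient may be 0 / 0. *)
Fixpoint gbin (R : nzRingType) (x : R) (n k : nat) : R :=
  match n, k with
  | _, 0%N => 1
  | 0%N, _.+1 => 0
  | n'.+1, k'.+1 => gbin x n' k' + x ^+ k'.+1 * gbin x n' k'.+1
  end.

Lemma gbin0 (R : nzRingType) (x : R) n : gbin x n 0 = 1.
Proof. by case: n. Qed.

Lemma gbin_pascal (R : nzRingType) (x : R) n k :
  gbin x n.+1 k.+1 = gbin x n k + x ^+ k.+1 * gbin x n k.+1.
Proof. by []. Qed.

Lemma gbin_small (R : nzRingType) (x : R) n k :
  (n < k)%N -> gbin x n k = 0.
Proof.
elim: n k => [|n IHn] [|k] //= ltnk.
by rewrite !IHn ?mulr0 ?addr0 //; lia.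
Qed.

Lemma gbinn (R : nzRingType) (x : R) n : gbin x n n = 1.
Proof. by elim: n => //= n ->; rewrite gbin_small // mulr0 addr0. Qed.

Arguments gbin : simpl never.

Lemma rmorph_gbin (R S : nzRingType) (f : {rmorphism R -> S}) x n k :
  f (gbin x n k) = gbin (f x) n k.
Proof.
elim: n k => [|n IHn] [|k]; rewrite ?gbin0 ?rmorph0 ?rmorph1 //.
by rewrite !gbin_pascal rmorphD rmorphM rmorphXn !IHn.
Qed.

(** This replaces the product formula for [n, k] wherever 1 - x^i may fail to be
    invertible. The induction step computes (1 - x^(n+1)) [n, k] from either
    side. *)
Lemma gbin_row_step (R : comNzRingType) (x : R) n k :
  (1 - x ^+ k.+1) * gbin x n k.+1 = (1 - x ^+ (n - k)) * gbin x n k.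
Proof.
elim: n k => [|n IHn] k; first by rewrite sub0n expr0 subrr mul0r mulr0.
have [ltnk|lekn] := ltnP n k.
  rewrite (@gbin_small _ _ _ k.+1) ?mulr0; last lia.
  by rewrite (_ : n.+1 - k = 0)%N ?expr0 ?subrr ?mul0r //; lia.
transitivity ((1 - x ^+ n.+1) * gbin x n k).
  have -> : x ^+ n.+1 = x ^+ k.+1 * x ^+ (n - k)
    by rewrite -exprD; congr (x ^+ _); lia.
  rewrite gbin_pascal mulrDr mulrCA IHn; ring.
case: k lekn => [|k] lekn; first by rewrite subn0 !gbin0.
have -> : x ^+ n.+1 = x ^+ k.+1 * x ^+ (n - k)
  by rewrite -exprD; congr (x ^+ _); lia.
have := IHn k; rewrite gbin_pascal subSS => IH.
by rewrite mulrDr -IH; ring.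
Qed.

(** The two q-Pascal rules differ exactly by [gbin_row_step]. *)
Lemma gbin_pascal_dual (R : comNzRingType) (x : R) n k :
  gbin x n.+1 k.+1 = x ^+ (n - k) * gbin x n k + gbin x n k.+1.
Proof.
apply/eqP; rewrite gbin_pascal -subr_eq0; apply/eqP.
have := gbin_row_step x n k => /eqP; rewrite -subr_eq0 => /eqP step.
by rewrite -[RHS]oppr0 -step; ring.
Qed.

Lemma gbin_absorb (R : comNzRingType) (x : R) n k :
  (1 - x ^+ k.+1) * gbin x n.+1 k.+1 = (1 - x ^+ n.+1) * gbin x n k.
Proof.
have [ltnk|lekn] := ltnP n k.
  by rewrite !gbin_small ?mulr0 //; lia.
have -> : x ^+ n.+1 = x ^+ k.+1 * x ^+ (n - k)
  by rewrite -exprD; congr (x ^+ _); lia.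
by rewrite gbin_pascal mulrDr mulrCA gbin_row_step; ring.
Qed.

Lemma gbin_sym (R : comNzRingType) (x : R) k l :
  gbin x (k + l) k = gbin x (k + l) l.
Proof.
move E: (k + l)%N => n; elim: n k l E => [|n IHn] [|k] [|l] // E.
- have -> : l = n by lia.
  by rewrite gbin0 gbinn.
- have -> : k = n by lia.
  by rewrite gbin0 gbinn.
rewrite [LHS]gbin_pascal [RHS]gbin_pascal_dual addrC.
have -> : gbin x n k = gbin x n l.+1 by apply: IHn; lia.
have -> : gbin x n k.+1 = gbin x n l by apply: IHn; lia.
by congr (x ^+ _ * _ + _); lia.
Qed.

(** * The alternating diagonal sum *)

Definition alt_sum (R : nzRingType) (x : R) (M : nat) : R :=
  \sum_(k < M.+1) (-1) ^+ k * x ^+ 'C(k, 2) * gbin x (M - k) k.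

(** Inserting t^k in the terms of [alt_sum x M] gives a polynomial in t whose
    value at t = 1 is [alt_sum x M]; this is x^M times its value at t = 1/x. The
    two q-Pascal rules relate the values at 1 and at 1/x, so that the pair of
    sums is closed under recursion in M. *)
Definition alt_sum_twist (R : nzRingType) (x : R) (M : nat) : R :=
  \sum_(k < M.+1) (-1) ^+ k * x ^+ 'C(k, 2) * x ^+ (M - k) * gbin x (M - k) k.

(** From the dual q-Pascal rule applied to [M+2-k, k]; the part with k - 1 below
    reindexes to the twisted sum, as x^(M-2k) x^(k(k+1)/2) =
    x^(k(k-1)/2) x^(M-k). *)
Lemma alt_sum_dual_rec (R : comNzRingType) (x : R) M :
  alt_sum x M.+2 = alt_sum x M.+1 - alt_sum_twist x M.
Proof.
rewrite /alt_sum big_ord_recl big_ord_recr [X in _ = X - _]big_ord_recl /=.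
rewrite /bump /= !add1n subnn /= mulr0 addr0 !gbin0 -addrA; congr (_ + _).
rewrite /alt_sum_twist -sumrB; apply: eq_bigr => k _.
have lekM : (k <= M)%N by rewrite -ltnS.
rewrite /bump /= !add1n !subSS subSn // gbin_pascal_dual binS bin1 exprD.
(* The truncated exponent M - k - k is wrong exactly where [M-k, k] is 0. *)
have [ltMk|leM] := ltnP (M - k) k; first by rewrite (gbin_small x ltMk); ring.
have -> : x ^+ (M - k) = x ^+ k * x ^+ (M - k - k)
  by rewrite -exprD; congr (x ^+ _); lia.
by rewrite exprS; ring.
Qed.

Lemma alt_sum_twist_rec (R : comNzRingType) (x : R) M :
  alt_sum_twist x M.+2 = x ^+ M.+2 * alt_sum x M.+1 - x ^+ M.+1 * alt_sum x M.
Proof.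
rewrite /alt_sum_twist /alt_sum big_ord_recl big_ord_recr.
rewrite [X in _ = _ * X - _]big_ord_recl /=.
rewrite /bump /= !add1n subnn subn0 /= mulr0 addr0 !gbin0 mulrDr -addrA.
congr (_ + _); first by ring.
rewrite !mulr_sumr -sumrB; apply: eq_bigr => k _.
have lekM : (k <= M)%N by rewrite -ltnS.
rewrite /bump /= !add1n !subSS subSn // gbin_pascal binS bin1 exprD.
have -> : x ^+ M.+2 = x ^+ (M - k).+1 * x ^+ k.+1
  by rewrite -exprD; congr (x ^+ _); lia.
have -> : x ^+ M.+1 = x ^+ (M - k).+1 * x ^+ k
  by rewrite -exprD; congr (x ^+ _); lia.
by rewrite [(-1) ^+ k.+1]exprS; ring.
Qed.

(** Eliminating the twisted sum gives a four-term recurrence, which says that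
    S_(M+3) + x^(M+1) S_M does not depend on M; it is 0 at M = 0. *)
Lemma alt_sum_rec3 (R : comNzRingType) (x : R) M :
  alt_sum x M.+3 = - (x ^+ M.+1 * alt_sum x M).
Proof.
elim: M => [|M IHM].
  rewrite !alt_sum_dual_rec /alt_sum /alt_sum_twist !big_ord_recr !big_ord0 /=.
  by rewrite !subn0 !subnn !gbin0 /gbin /=; ring.
by rewrite alt_sum_dual_rec IHM alt_sum_twist_rec; ring.
Qed.

(** The sign (-1)^M is absorbed so that shifting M by 3 leaves the Legendre symbol
    unchanged; the exponent grows by M + 1, since
    (M+3)(M+2) = 6 (M+1) + M(M-1). *)
Lemma alt_sum_closed (R : comNzRingType) (x : R) M :
  (-1) ^+ M * alt_sum x M
    = (legendre3 M.+1%:Z)%:~R * x ^+ ((M * (M - 1)) %/ 6).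
Proof.
have [m leMm] := ubnP M; elim: m M leMm => // m IHm [|[|[|M]]] ltMm.
- by rewrite /alt_sum big_ord1 /legendre3 !gbin0 /gbin /=; ring.
- by rewrite /alt_sum !big_ord_recr big_ord0 /legendre3 !gbin0 /gbin /=; ring.
- by rewrite /alt_sum !big_ord_recr big_ord0 /legendre3 !gbin0 /gbin /=; ring.
have -> : (M.+3 * (M.+3 - 1) = M.+1 * 6 + M * (M - 1))%N by nia.
have -> : legendre3 M.+4 = legendre3 M.+1.
  by rewrite /legendre3 (_ : M.+4%:Z = M.+1%:Z + 3) ?modzDr //; lia.
rewrite divnMDl // exprD mulrCA -IHm; last lia.
by rewrite alt_sum_rec3 !exprS; ring.
Qed.

(** * Reflection of Gaussian binomials at a root of unity *)

Lemma one_sub_prim_expr_neq0 (F : fieldType) (n k : nat) (z : F) :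
  n.-primitive_root z -> (0 < k < n)%N -> 1 - z ^+ k != 0.
Proof.
move=> prim_z /andP[k_gt0 ltkn].
rewrite subr_eq0 eq_sym -(prim_order_dvd prim_z).
by apply/negP => /dvdn_leq; lia.
Qed.

(** By induction on m: passing from m to m + 1 multiplies the left binomial by
    (1 - z^(-(s+m+1))) / (1 - z^(m+1)) and the right one by
    (1 - z^(s+m+1)) / (1 - z^(m+1)). The power of z on the left clears the
    negative exponents; m < n makes the denominators nonzero. *)
Lemma gbin_reflect (F : fieldType) (n a s m : nat) (z : F) :
    n.-primitive_root z -> (m < n)%N -> (s + m < a * n)%N ->
  z ^+ (s * m + 'C(m.+1, 2)) * gbin z (a * n - 1 - s) m
    = (-1) ^+ m * gbin z (s + m) m.
Proof.
move=> prim_z; elim: m => [|m IHm] ltmn ltan.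
  by rewrite muln0 !gbin0 !mulr1.
have nz : 1 - z ^+ m.+1 != 0 by apply: one_sub_prim_expr_neq0 prim_z _; lia.
apply: (mulfI nz).
rewrite addnS [RHS]mulrCA gbin_absorb [LHS]mulrCA gbin_row_step.
have IH := IHm (ltnW ltmn); have {}/IH IH : (s + m < a * n)%N by lia.
have -> : (s * m.+1 + 'C(m.+2, 2) = (s + m).+1 + (s * m + 'C(m.+1, 2)))%N.
  by rewrite [in LHS]binS bin1; lia.
have zan : z ^+ (s + m).+1 * z ^+ (a * n - 1 - s - m) = 1.
  rewrite -exprD (_ : _ + _ = n * a)%N; last lia.
  by rewrite exprM (prim_expr_order prim_z) expr1n.
transitivity ((z ^+ (s + m).+1 - z ^+ (s + m).+1 * z ^+ (a * n - 1 - s - m))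
   * (z ^+ (s * m + 'C(m.+1, 2)) * gbin z (a * n - 1 - s) m)).
  by rewrite exprD; ring.
by rewrite IH zan [(-1) ^+ m.+1]exprS; ring.
Qed.

(** * The trinomial coefficient at a root of unity *)

Lemma double_bin2S n : (2 * 'C(n.+1, 2) = n.+1 * n)%N.
Proof. by elim: n => [|n IHn] //; rewrite binS bin1; lia. Qed.

(** The balance of exponents in the k-th term, with M = 2k + m: the two
    reflection formulas contribute k(k+1)/2 and k m + m(m+1)/2, and the alternating
    sum needs k(k-1)/2. The excess is a multiple of J + M + 1 = an. *)
Lemma trinomial_exponent J k m :
  ('C((k + m + k).+1, 2) + k * (k + J)
     = (J + (k + m + k)).+1 * k
       + ('C(k, 2) + 'C(k.+1, 2) + (k * m + 'C(m.+1, 2))))%N.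
Proof.
have := double_bin2S (k + m + k); have := double_bin2S k.
have := double_bin2S m; have := binS k 1; rewrite bin1; nia.
Qed.

Definition gtrinom (R : nzRingType) (x : R) (n j : nat) : R :=
  \sum_(k < n.+1) x ^+ (k * (k + j)) * gbin x n k * gbin x (n - k) (k + j).

Lemma rmorph_gtrinom (R S : nzRingType) (f : {rmorphism R -> S}) x n j :
  f (gtrinom x n j) = gtrinom (f x) n j.
Proof.
rewrite /gtrinom rmorph_sum; apply: eq_bigr => k _.
by rewrite !rmorphM rmorphXn !rmorph_gbin.
Qed.

(** Termwise: the reflection formula with s = 0 evaluates [J+M, k] and with s = k,
    m = M - 2k evaluates [J+M-k, k+J]. *)
Lemma gtrinom_root_of_unity (F : fieldType) (n a J M : nat) (z : F) :
    n.-primitive_root z -> (M < n)%N -> (J + M).+1 = (a * n)%N ->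
  z ^+ 'C(M.+1, 2) * gtrinom z (J + M) J = (-1) ^+ M * alt_sum z M.
Proof.
move=> prim_z ltMn eJM.
have -> : alt_sum z M = \sum_(k < (J + M).+1)
    (if (k < M.+1)%N then (-1) ^+ k * z ^+ 'C(k, 2) * gbin z (M - k) k else 0).
  rewrite -big_mkcond /alt_sum.
  rewrite (big_ord_widen (J + M).+1
    (fun k => (-1) ^+ k * z ^+ 'C(k, 2) * gbin z (M - k) k)) //; lia.
rewrite /gtrinom !mulr_sumr; apply: eq_bigr => k _.
have [le2kM|lt2kM] := leqP k.*2 M; last first.
  rewrite (@gbin_small _ _ (J + M - k)) ?mulr0; last lia.
  by case: ifP => _; rewrite ?(@gbin_small _ _ (M - k)) ?mulr0 //; lia.
(* [J+M-k, k+J] is the binomial with lower index m, by symmetry. *)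
pose m := (M - k.*2)%N.
have eM : M = (k + m + k)%N by rewrite /m; lia.
rewrite ifT; last lia.
have eN : (J + M = a * n - 1)%N by lia.
have kth : z ^+ 'C(k.+1, 2) * gbin z (J + M) k = (-1) ^+ k.
  have := @gbin_reflect _ n a 0 k z prim_z.
  rewrite mul0n !add0n subn0 gbinn mulr1.
  by rewrite -eN; apply; lia.
have mth : z ^+ (k * m + 'C(m.+1, 2)) * gbin z (J + M - k) (k + J)
           = (-1) ^+ m * gbin z (M - k) k.
  have -> : (M - k = k + m)%N by lia.
  rewrite gbin_sym -(@gbin_reflect _ n a k m z prim_z); try lia.
  rewrite -eN (_ : J + M - k = (k + J) + m)%N; last lia.
  by rewrite gbin_sym.
have ez : z ^+ 'C(M.+1, 2) * z ^+ (k * (k + J))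
    = z ^+ 'C(k, 2) * z ^+ 'C(k.+1, 2) * z ^+ (k * m + 'C(m.+1, 2)).
  rewrite -!exprD.
  have -> : ('C(M.+1, 2) + k * (k + J) =
     n * (a * k) + ('C(k, 2) + 'C(k.+1, 2) + (k * m + 'C(m.+1, 2))))%N.
    rewrite mulnA [(n * a)%N]mulnC -eJM.
    by have := trinomial_exponent J k m; rewrite -eM.
  by rewrite exprD exprM (prim_expr_order prim_z) expr1n mul1r.
transitivity (z ^+ 'C(k, 2) * (z ^+ 'C(k.+1, 2) * gbin z (J + M) k) *
   (z ^+ (k * m + 'C(m.+1, 2)) * gbin z (J + M - k) (k + J))).
  rewrite !mulrA ez; ring.
have -> : (-1) ^+ M = (-1) ^+ k * (-1) ^+ m * (-1) ^+ k :> F.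
  by rewrite -!exprD -eM.
have sqk : (-1) ^+ k * (-1) ^+ k = 1 :> F by rewrite -expr2 sqrr_sign.
rewrite kth mth; transitivity (((-1) ^+ k * (-1) ^+ k) *
    ((-1) ^+ k * (-1) ^+ m * z ^+ 'C(k, 2) * gbin z (M - k) k)); last by ring.
by rewrite sqk; ring.
Qed.

(** * The q-trinomial coefficient as a polynomial *)

Lemma one_sub_qX_neq0 i : (0 < i)%N -> 1 - q ^+ i != 0.
Proof.
move=> i_gt0; rewrite /q /of_poly -tofracXn -tofrac1 -tofracB tofrac_eq0.
rewrite subr_eq0 eq_sym; apply/eqP => /(congr1 (fun p : {poly int} => size p)).
rewrite size_polyXn size_poly1; lia.
Qed.

Lemma qpoch_neq0 n : qpoch q n != 0.
Proof.
by apply/prodf_neq0 => i _; rewrite -exprS one_sub_qX_neq0.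
Qed.

Lemma gbin_qpoch n k :
  (k <= n)%N -> gbin q n k * (qpoch q k * qpoch q (n - k)) = qpoch q n.
Proof.
have qpochS i : qpoch q i.+1 = qpoch q i * (1 - q ^+ i.+1).
  by rewrite /qpoch big_ord_recr /= exprS.
elim: k => [|k IHk] ltkn.
  by rewrite gbin0 subn0 /qpoch big_ord0 !mul1r.
rewrite -[RHS](IHk (ltnW ltkn)) (_ : n - k = (n - k.+1).+1)%N; last lia.
rewrite !qpochS.
transitivity ((1 - q ^+ k.+1) * gbin q n k.+1
    * (qpoch q k * qpoch q (n - k.+1))).
  by ring.
rewrite gbin_row_step (_ : n - k = (n - k.+1).+1)%N; last lia.
by ring.
Qed.

Lemma qbinomE n (k : nat) : qbinom n k%:Z = gbin q n k.
Proof.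
rewrite /qbinom; case: ifP => [lekn | /negbT]; last first.
  by rewrite -ltnNge => /gbin_small ->.
apply: canLR (mulfK _) _; first by rewrite mulf_neq0 ?qpoch_neq0.
by rewrite gbin_qpoch.
Qed.

Lemma qtrinomE n (j : nat) : qtrinom n j%:Z = of_poly (gtrinom 'X n j).
Proof.
rewrite [RHS](rmorph_gtrinom (@tofrac {poly int})).
by apply: eq_bigr => k _; rewrite -PoszD -PoszM !qbinomE.
Qed.

(** * Congruences as equalities at a root of unity *)

(** Euclidean division by a monic polynomial is possible over the integers. The
    remainder vanishes at z, and is too small to be a nonzero multiple of the
    minimal polynomial of z over the rationals. *)
Lemma Cyclotomic_dvd (n : nat) (z : algC) (p : {poly int}) :
    n.-primitive_root z -> root (map_poly intr p) z ->
  exists r : {poly int}, p = 'Phi_n * r.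
Proof.
move=> prim_z pz0.
have monP := Cyclotomic_monic n.
have ePhi := Cintr_Cyclotomic prim_z.
set r := Pdiv.CommonRing.rmodp p 'Phi_n.
have ep : p = Pdiv.CommonRing.rdivp p 'Phi_n * 'Phi_n + r
  by apply: Pdiv.RingMonic.rdivp_eq.
have ltr : (size r < size 'Phi_n)%N.
  by rewrite Pdiv.CommonRing.ltn_rmodp monic_neq0.
suff r0 : r = 0.
  by exists (Pdiv.CommonRing.rdivp p 'Phi_n); rewrite {1}ep r0 addr0 mulrC.
have rz0 : root (map_poly intr r) z.
  move: pz0; rewrite ep rmorphD rmorphM /= ePhi /root !hornerE.
  have /eqP -> : (cyclotomic z n).[z] == 0 by rewrite -rootE root_cyclotomic.
  by rewrite mulr0 add0r.
have [m [em _ dvdm]] := minCpolyP z.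
have eratr : map_poly intr r
    = map_poly ratr (map_poly intr r : {poly rat}) :> {poly algC}.
  by rewrite -map_poly_comp; apply: eq_map_poly => c /=; rewrite ratr_int.
move: rz0; rewrite eratr dvdm => mr.
apply/eqP; apply: contraTT ltr => nz_r; rewrite -leqNgt.
have inj : injective (intr : int -> rat) by apply: intr_inj.
have -> : size r = size (map_poly intr r : {poly rat}).
  by rewrite size_map_inj_poly.
have -> : size 'Phi_n = size m.
  rewrite -(size_map_inj_poly (@intr_inj algC) (rmorph0 _)) ePhi.
  by rewrite -(minCpoly_cyclotomic prim_z) em size_map_poly.
by apply: dvdp_leq mr; rewrite map_poly_eq0_id0 // intr_eq0 lead_coef_eq0.
Qed.

(** The denominator q^e is cleared in the hypothesis: only polynomials are
    evaluated. *)
Lemma laurent_eqmod_root_of_unity (n e : nat) (z : algC) (p r : {poly int}) :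
    n.-primitive_root z ->
    (map_poly intr p).[z] * z ^+ e = (map_poly intr r).[z] ->
  laurent_eqmod 'Phi_n (of_poly p) (of_poly r / q ^+ e).
Proof.
move=> prim_z epr.
have [|s es] := @Cyclotomic_dvd n z (p * 'X^e - r) prim_z.
  by rewrite /root rmorphB rmorphM /= map_polyXn !hornerE epr subrr.
have qe_neq0 : q ^+ e != 0 by rewrite expf_neq0 // tofrac_eq0 polyX_eq0.
exists (of_poly s / q ^+ e); first by exists s, e.
rewrite mulrA -[of_poly _ * of_poly s]tofracM -es tofracB tofracM tofracXn.
by rewrite mulrBl mulfK.
Qed.

Theorem theorem1p4 (a n j : nat) (ha : (1 <= a)%N) (hn : odd n)
    (hj : (j <= n - 1)%N) :
  laurent_eqmod 'Phi_n
    (qtrinom (a * n - 1) (a%:Z * n%:Z - n%:Z + j%:Z))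
    ((legendre3 (n%:Z - j%:Z))%:~R *
       q ^ (((n%:Z - j%:Z - 1) * (n%:Z - j%:Z - 2) %/ 6)%Z
              - ((j%:Z ^+ 2 + j%:Z) %/ 2)%Z)).
Proof.
have n_gt0 : (0 < n)%N by case: n hn {hj}.
have [z prim_z] := C_prim_root_exists n_gt0.
pose M := (n - 1 - j)%N; pose J := ((a - 1) * n + j)%N.
have eJM : (J + M).+1 = (a * n)%N by rewrite /J /M; nia.
have -> : a%:Z * n%:Z - n%:Z + j%:Z = J%:Z by rewrite /J; nia.
have -> : (a * n - 1 = J + M)%N by lia.
have -> : n%:Z - j%:Z = M.+1%:Z by rewrite /M; lia.
have -> : (((M.+1%:Z - 1) * (M.+1%:Z - 2)) %/ 6)%Z = ((M * (M - 1)) %/ 6)%N%:Z.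
  by rewrite -divz_nat; congr (_ %/ _)%Z; case: (M) => [|k]; nia.
have -> : ((j%:Z ^+ 2 + j%:Z) %/ 2)%Z = 'C(j.+1, 2)%:Z.
  have -> : j%:Z ^+ 2 + j%:Z = 'C(j.+1, 2)%:Z * 2.
    by have := double_bin2S j; rewrite expr2; nia.
  by rewrite mulzK.
set e1 := (_ %/ 6)%N; set e2 := 'C(_, 2); set l := legendre3 _.
have -> : l%:~R * q ^ (e1%:Z - e2%:Z) = of_poly (l%:~R * 'X^e1) / q ^+ e2.
  rewrite expfzDr ?tofrac_eq0 ?polyX_eq0 // -exprnN mulrA /of_poly.
  by rewrite rmorphM rmorph_int rmorphXn.
rewrite qtrinomE; apply: (laurent_eqmod_root_of_unity prim_z).
have -> : (map_poly intr (gtrinom 'X (J + M) J)).[z] = gtrinom z (J + M) J.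
  rewrite rmorph_gtrinom /= map_polyX.
  have -> : gtrinom z (J + M) J = gtrinom ('X.[z]) (J + M) J by rewrite hornerX.
  exact: (rmorph_gtrinom (horner_eval z)).
have -> : (map_poly intr (l%:~R * 'X^e1)).[z] = l%:~R * z ^+ e1.
  rewrite rmorphM /= map_polyXn rmorph_int hornerM hornerXn; congr (_ * _).
  exact: (rmorph_int (horner_eval z)).
rewrite /l -alt_sum_closed -(gtrinom_root_of_unity prim_z _ eJM);
  last by rewrite /M; lia.
rewrite mulrC; congr (_ * _).
(* n odd: the exponents of z agree up to the multiples n M and n (n - 1) / 2. *)
have zn i : z ^+ (n * i) = 1 by rewrite exprM (prim_expr_order prim_z) expr1n.
rewrite -[LHS]mulr1 -[RHS]mulr1 -{1}(zn M) -{1}(zn (n./2)) -!exprD.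
congr (_ ^+ _); rewrite /e2.
have := double_bin2S j; have := double_bin2S M.
have : n = (j + M).+1 by rewrite /M; lia.
have : n = (n./2 * 2).+1 by lia.
nia.
Qed.
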